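(* Let $\Omega=(0,1)\times(0,1)\subset\mathbb{R}^2$ and let $h:[0,1]\to\mathbb{R}$ be a bounded function with $h(0)=0$, $h(x_1)>0$ for $x_1\in(0,1]$, $h\in C^1(0,1]$, and suppose there exist constants $C>0$ and $\theta\in(0,1)$ such that $$\sup_{x\in\Omega,\ 0<r\le d}\frac{\int_{B(x,r)\cap\Omega}h(x_1)^{-1}\,dx}{|B(x,r)\cap\Omega|^{\theta}}\le C,$$ where $d$ is the diameter of $\Omega$. Then the embedding $\mathcal{H}_{h,0}^1(\Omega)\hookrightarrow L^2(\Omega)$ is compact.
   Context: $B(x,r)$ is the Euclidean ball with center $x$ and radius $r$, $|\cdot|$ is Lebesgue measure. $\mathcal{H}_h^1(\Omega)=\{u\in L^2(\Omega)\mid \partial_{x_1}u\in L^2(\Omega),\ \sqrt{h(x_1)}\,\partial_{x_2}u\in L^2(\Omega)\}$ (distributional derivatives), with norm $\|u\|_{\mathcal{H}_h^1(\Omega)}=\big(\|u\|_{L^2(\Omega)}^2+\|\partial_{x_1}u\|_{L^2(\Omega)}^2+\|\sqrt{h(x_1)}\partial_{x_2}u\|_{L^2(\Omega)}^2\big)^{1/2}$. $\mathcal{H}_{h,0}^1(\Omega)$ is the closure of $C_0^\infty(\Omega)$ in $\mathcal{H}_h^1(\Omega)$. *)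

(* Defs.v *)
From HB Require Import structures.
From mathcomp Require Import all_boot all_order all_algebra.
From mathcomp Require Import all_classical all_reals all_analysis.
Set Implicit Arguments. Unset Strict Implicit. Unset Printing Implicit Defensive.
Import Order.TTheory GRing.Theory Num.Theory.
Import numFieldNormedType.Exports.
Local Open Scope classical_set_scope.
Local Open Scope ring_scope.

Section Defs.
Variable R : realType.

Definition leb2 := ((@lebesgue_measure R) \x (@lebesgue_measure R))%E.

Definition Omega : set (R * R) := `]0%R, 1%R[ `*` `]0%R, 1%R[.

Definition eball (x : R * R) (r : R) : set (R * R) :=
  [set y | (y.1 - x.1) ^+ 2 + (y.2 - x.2) ^+ 2 < r ^+ 2].

Definition pd (b : bool) (f : R * R -> R) : R * R -> R :=
  fun x => if b then derive1 (fun t => f (x.1, t)) x.2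
           else derive1 (fun t => f (t, x.2)) x.1.

Definition pderivable (b : bool) (f : R * R -> R) (x : R * R) : Prop :=
  if b then derivable (fun t => f (x.1, t)) x.2 1
  else derivable (fun t => f (t, x.2)) x.1 1.

Definition smooth2 (f : R * R -> R) : Prop :=
  forall s : seq bool,
    continuous (foldr pd f s) /\
    forall (b : bool) (x : R * R), pderivable b (foldr pd f s) x.

Definition Cc_inf (f : R * R -> R) : Prop :=
  smooth2 f /\
  exists K : set (R * R), compact K /\ K `<=` Omega /\
    forall x, ~ K x -> f x = 0.

Definition L2 (u : R * R -> R) : Prop :=
  measurable_fun Omega u /\
  (\int[leb2]_(x in Omega) ((u x) ^+ 2)%:E < +oo)%E.

Definition weak_pd (b : bool) (u g : R * R -> R) : Prop :=
  forall phi, Cc_inf phi ->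
    (\int[leb2]_(x in Omega) (u x * pd b phi x)%:E
     = - \int[leb2]_(x in Omega) (g x * phi x)%:E)%E.

Definition H1h_wit (h : R -> R) (u g1 g2 : R * R -> R) : Prop :=
  L2 u /\ L2 g1 /\ measurable_fun Omega g2 /\
  L2 (fun x => Num.sqrt (h x.1) * g2 x) /\
  weak_pd false u g1 /\ weak_pd true u g2.

Definition H1h_norm2 (h : R -> R) (v dv1 dv2 : R * R -> R) : \bar R :=
  (\int[leb2]_(x in Omega) ((v x) ^+ 2)%:E
   + \int[leb2]_(x in Omega) ((dv1 x) ^+ 2)%:E
   + \int[leb2]_(x in Omega) ((Num.sqrt (h x.1) * dv2 x) ^+ 2)%:E)%E.

Definition H1h0_wit (h : R -> R) (u g1 g2 : R * R -> R) : Prop :=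
  H1h_wit h u g1 g2 /\
  exists phi : nat -> R * R -> R, (forall k, Cc_inf (phi k)) /\
    (fun k => H1h_norm2 h (fun x => phi k x - u x)
                (fun x => pd false (phi k) x - g1 x)
                (fun x => pd true (phi k) x - g2 x)) @ \oo --> 0%E.

Definition compact_embedding_H1h0_L2 (h : R -> R) : Prop :=
  forall (u : nat -> R * R -> R) (M : R),
    (forall n, exists g1 g2, H1h0_wit h (u n) g1 g2 /\
        (H1h_norm2 h (u n) g1 g2 <= M%:E)%E) ->
    exists (sigma : nat -> nat) (v : R * R -> R),
      (forall n m, (n < m)%N -> (sigma n < sigma m)%N) /\ L2 v /\
      (fun n => (\int[leb2]_(x in Omega) ((u (sigma n) x - v x) ^+ 2)%:E)%E)
        @ \oo --> 0%E.

End Defs.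

(* Main.v *)
Require Import Defs.
From HB Require Import structures.
From mathcomp Require Import all_boot all_order all_algebra.
From mathcomp Require Import all_classical all_reals all_analysis.
From mathcomp Require Import measurable_realfun ring lra.
Set Implicit Arguments. Unset Strict Implicit. Unset Printing Implicit Defensive.
Import Order.TTheory GRing.Theory Num.Theory.
Import numFieldNormedType.Exports.
Local Open Scope classical_set_scope.
Local Open Scope ring_scope.

(* By density it suffices to treat test functions phi with bounded energies.
   For x1 < d, phi(0, .) = 0 gives phi(x)^2 <= d * int (d_1 phi)^2(t, x2) dt, so
   little mass sits near the degenerate edge; for x1 >= d, h is bounded below and
   int (d_2 phi)^2(x1, s) ds is controlled by the weighted energy.  Hence phi is
   L2-close to a step function built from its samples at the abscissas i/n^2 on
   n horizontal lines of low energy, one in each band of height 1/n.  These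
   finitely many samples are bounded, so they converge along an ultrafilter on
   nat, which makes the sequence totally bounded in L2; completeness of L2
   concludes. *)

(** * Measurability, increments and Tonelli *)

Section Measurability.
Variable R : realType.

Lemma open_measurable_prod (U : set (R * R)) : open U -> measurable U.
Proof.
move=> oU.
pose box (q : rat * rat * rat * rat) : set (R * R) :=
  `]ratr q.1.1.1, ratr q.1.1.2[ `*` `]ratr q.1.2, ratr q.2[.
pose F q := if pselect (box q `<=` U) is left _ then box q else set0.
have -> : U = \bigcup_q F q.
  apply/seteqP; split=> [[x y] Uxy|z [q _]]; last first.
    by rewrite /F; case: pselect => // + qz; apply.
  have [e /= e0 xyU] : nbhs_ball (x, y) U.
    by apply/nbhs_ballP; move: oU; rewrite openE; apply.
  have below (t : R) : exists q : rat, t - e < ratr q < t.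
    have /rat_in_itvoo[q] : t - e < t by rewrite ltrBlDr ltrDl.
    by rewrite in_itv => ?; exists q.
  have above (t : R) : exists q : rat, t < ratr q < t + e.
    have /rat_in_itvoo[q] : t < t + e by rewrite ltrDl.
    by rewrite in_itv => ?; exists q.
  have [q1 /andP[xq1 q1x]] := below x; have [q2 /andP[xq2 q2x]] := above x.
  have [q3 /andP[yq3 q3y]] := below y; have [q4 /andP[yq4 q4y]] := above y.
  exists (q1, q2, q3, q4) => //; rewrite /F; case: pselect => [_|]; last first.
    case=> -[z1 z2] /= [] /=; rewrite !in_itv/= => /andP[z1q z1q'] /andP[z2q z2q'].
    by apply: xyU; split; rewrite /ball/= ltr_distlC; apply/andP; split; lra.
  by split; rewrite /= in_itv/= ?q1x ?xq2 ?q3y ?yq4.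
apply: countable_bigcupT_measurable; first exact: countableP.
move=> q; rewrite /F; case: pselect => _ //; exact: measurableX.
Qed.

Lemma continuous_measurable_prod (f : R * R -> R) :
  continuous f -> measurable_fun [set: R * R] f.
Proof.
move=> cf; apply: (measurability (RGenOInfty.G (R:=R))).
  exact: RGenOInfty.measurableE.
move=> _ [_ [x ->] <-]; rewrite setTI; apply: open_measurable_prod.
by move/continuousP: cf; apply; exact: rray_open.
Qed.

End Measurability.

Section IncrementBound.
Variable R : realType.
Local Notation mu := (@lebesgue_measure R).

Lemma sqr_increment_le (f : R -> R) (a b : R) : a < b ->
  (forall x, derivable f x 1) -> continuous (derive1 f) ->
  (((f b - f a) ^+ 2)%:E <=
    (b - a)%:E * \int[mu]_(t in `[a, b]) ((derive1 f t) ^+ 2)%:E)%E.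
Proof.
move=> ab df cf'.
pose c := (f b - f a) / (b - a).
pose g t := 2 * c * derive1 f t - c ^+ 2.
pose F : R -> R := (2 * c) \*: f - (c ^+ 2) \*: id.
have ba0 : 0 < b - a by rewrite subr_gt0.
have cg : continuous g.
  move=> t; apply: cvgB; last exact: cvg_cst.
  by apply: cvgMr; exact: cf'.
have csq : continuous (fun t => (derive1 f t) ^+ 2).
  by move=> t; apply: cvgM; exact: cf'.
have dF (t : R) : is_derive t 1 F (g t).
  have dft : is_derive t (1 : R) f (derive1 f t).
    by rewrite derive1E; exact/derivableP.
  have := is_deriveB (is_deriveZ (2 * c) dft) (is_deriveZ (c ^+ 2) (is_derive_id t 1)).
  by rewrite /GRing.scale/= mulr1.
have cF : continuous F.
  by move=> t; apply/differentiable_continuous/derivable1_diffP/ex_derive.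
have intg : (\int[mu]_(t in `[a, b]) (g t)%:E = (F b)%:E - (F a)%:E)%E.
  apply: continuous_FTC2 => //.
  - exact: continuous_subspaceT.
  - split; first by move=> t _; exact: ex_derive.
    + exact/cvg_at_right_filter/cF.
    + exact/cvg_at_left_filter/cF.
  - by move=> t _; rewrite derive1E derive_val.
have Fba : F b - F a = (f b - f a) ^+ 2 / (b - a).
  have FE t : F t = 2 * c * f t - c ^+ 2 * t by [].
  by rewrite !FE /c; field; exact: lt0r_neq0.
have le_int : (\int[mu]_(t in `[a, b]) (g t)%:E <=
    \int[mu]_(t in `[a, b]) ((derive1 f t) ^+ 2)%:E)%E.
  apply: le_integral => //.
  - by apply: continuous_compact_integrable; [exact: segment_compact|exact: continuous_subspaceT].
  - by apply: continuous_compact_integrable; [exact: segment_compact|exact: continuous_subspaceT].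
  - move=> t _; rewrite lee_fin /g -subr_ge0.
    have -> : derive1 f t ^+ 2 - (2 * c * derive1 f t - c ^+ 2) = (derive1 f t - c) ^+ 2 by ring.
    exact: sqr_ge0.
rewrite -[leLHS]mul1e -(divff (lt0r_neq0 ba0)) EFinM -muleA lee_pmul2l//.
by rewrite -EFinM mulrC -Fba EFinB -intg.
Qed.

Lemma sqr_increment01_le (f : R -> R) (a b l : R) :
  0 <= a <= 1 -> 0 <= b <= 1 -> `|b - a| <= l ->
  (forall x, derivable f x 1) -> continuous (derive1 f) ->
  (((f b - f a) ^+ 2)%:E <=
    l%:E * \int[mu]_(t in `]0%R, 1%R[) ((derive1 f t) ^+ 2)%:E)%E.
Proof.
move=> + + + df cf'.
have mf' D : measurable D -> measurable_fun D (fun t => ((derive1 f t) ^+ 2)%:E).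
  move=> mD; apply/measurable_EFinP/(measurable_funS measurableT) => //.
  by apply: continuous_measurable_fun => t; apply: cvgM; exact: cf'.
wlog ab : a b / a <= b.
  move=> wl; have [ab|/ltW ba] := leP a b; first exact: wl.
  move=> a01 b01 abl; rewrite -[X in X ^+ 2]opprK sqrrN opprB.
  by apply: wl => //; rewrite distrC.
move=> /andP[a0 a1] /andP[b0 b1] abl.
have l0 : 0 <= l by apply: le_trans abl.
have [->|/eqP ab'] := eqVneq a b.
  rewrite subrr expr0n/= mule_ge0//; apply: integral_ge0 => t _.
  by rewrite lee_fin sqr_ge0.
have {ab ab'}ab : a < b by rewrite lt_neqAle ab andbT; exact/eqP.
apply: (le_trans (sqr_increment_le ab df cf')).
apply: lee_pmul.
- by rewrite lee_fin subr_ge0 ltW.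
- by apply: integral_ge0 => t _; rewrite lee_fin sqr_ge0.
- by rewrite lee_fin; apply: le_trans abl; exact: ler_norm.
rewrite -(integral_itv_bndoo true false); last exact: mf'.
apply: ge0_subset_integral => //.
- exact: mf'.
- by move=> t _; rewrite lee_fin sqr_ge0.
- move=> t /=; rewrite !in_itv/= => /andP[at_ tb].
  by rewrite (le_trans a0)//= (le_trans tb).
Qed.

End IncrementBound.

Section Tonelli.
Variable R : realType.
Local Notation mu := (@lebesgue_measure R).
Variables (A B : set R) (f : R * R -> \bar R).
Hypotheses (mA : measurable A) (mB : measurable B).
Hypotheses (mf : measurable_fun (A `*` B) f).
Hypothesis (f0 : forall x, (A `*` B) x -> (0 <= f x)%E).

Let mAB : measurable (A `*` B). Proof. exact: measurableX. Qed.

Let g := f \_ (A `*` B).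

Let mg : measurable_fun setT g.
Proof. by apply/(measurable_restrictT _ mAB). Qed.

Let g0 x : (0 <= g x)%E. Proof. exact: erestrict_ge0. Qed.

Let FE x : fubini_F mu g x = ((fun x => (\int[mu]_(y in B) f (x, y))%E) \_ A) x.
Proof.
rewrite /fubini_F /g patchE; case: ifPn => xA.
  rewrite [RHS]integral_mkcond; apply: eq_integral => y _.
  by rewrite !patchE in_setX xA.
rewrite integral0_eq// => y _; rewrite patchE in_setX.
by rewrite (negPf xA).
Qed.

Let GE y : fubini_G mu g y = ((fun y => (\int[mu]_(x in A) f (x, y))%E) \_ B) y.
Proof.
rewrite /fubini_G /g patchE; case: ifPn => yB.
  rewrite [RHS]integral_mkcond; apply: eq_integral => x _.
  by rewrite !patchE in_setX yB andbT.
rewrite integral0_eq// => x _; rewrite patchE in_setX.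
by rewrite (negPf yB) andbF.
Qed.

Lemma tonelli_setX1 :
  (\int[@leb2 R]_(z in A `*` B) f z =
   \int[mu]_(x in A) \int[mu]_(y in B) f (x, y))%E.
Proof.
rewrite integral_mkcond [RHS]integral_mkcond fubini_tonelli1//.
by apply: eq_integral => x _; exact: FE.
Qed.

Lemma tonelli_setX2 :
  (\int[@leb2 R]_(z in A `*` B) f z =
   \int[mu]_(y in B) \int[mu]_(x in A) f (x, y))%E.
Proof.
rewrite integral_mkcond [RHS]integral_mkcond fubini_tonelli2//.
by apply: eq_integral => x _; exact: GE.
Qed.

Lemma measurable_tonelli_setX1 :
  measurable_fun A (fun x => \int[mu]_(y in B) f (x, y))%E.
Proof.
apply/(measurable_restrictT _ mA).
rewrite -(funext FE); exact: measurable_fun_fubini_tonelli_F.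
Qed.

Lemma measurable_tonelli_setX2 :
  measurable_fun B (fun y => \int[mu]_(x in A) f (x, y))%E.
Proof.
apply/(measurable_restrictT _ mB).
rewrite -(funext GE); exact: measurable_fun_fubini_tonelli_G.
Qed.

End Tonelli.

(** * Completeness of L2 *)

Section L2Complete.
Context d (T : measurableType d) (R : realType) (mu : {measure set T -> \bar R}).
Variables (D : set T) (mD : measurable D).

Lemma sqr_telescope_le (f : nat -> R) n m :
  (f (n + m)%N - f n) ^+ 2 <=
    2 * 2^-1 ^+ n * \sum_(n <= k < n + m) 2 ^+ k * (f k.+1 - f k) ^+ 2.
Proof.
elim: m n => [|m IH] n.
  by rewrite addn0 subrr expr0n big_geq//= mulr0.
rewrite big_ltn ?addnS ?ltnS ?leq_addr// -addSn.
have := IH n.+1; rewrite !addSn.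
set S := \sum_(_ <= _ < _) _ => IHn.
have -> : 2 * 2^-1 ^+ n * (2 ^+ n * (f n.+1 - f n) ^+ 2 + S) =
  2 * (f n.+1 - f n) ^+ 2 + 2 * (2 * 2^-1 ^+ n.+1 * S).
  have pq : 2^-1 ^+ n * 2 ^+ n = 1 :> R by rewrite -exprMn mulVf ?expr1n.
  rewrite [2^-1 ^+ n.+1]exprS mulrDr [2 * _ * (_ * _)]mulrA -(mulrA 2) pq mulr1; congr (_ + _).
  by field.
apply: (le_trans _ (lerD (lexx _) (ler_wpM2l _ IHn))) => //.
set a := f n.+1; set b := f n; set c := f _.
rewrite -subr_ge0; have := sqr_ge0 ((a - b) - (c - a)).
by congr (0 <= _); ring.
Qed.

Lemma cvg_of_sqr_series (f : nat -> R) (S : R) :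
  (forall n, \sum_(0 <= k < n) 2 ^+ k * (f k.+1 - f k) ^+ 2 <= S) ->
  exists2 l : R, f @ \oo --> l &
    forall n, (f n - l) ^+ 2 <= 2 * 2^-1 ^+ n * S.
Proof.
move=> fS.
have fnm n m : (f (n + m)%N - f n) ^+ 2 <= 2 * 2^-1 ^+ n * S.
  apply: (le_trans (sqr_telescope_le f n m)); apply: ler_wpM2l.
    by rewrite mulr_ge0// exprn_ge0.
  apply: le_trans (fS (n + m)%N).
  rewrite [leRHS](big_cat_nat _ (leq_addr m n))//= lerDr sumr_ge0// => k _.
  by rewrite mulr_ge0 ?sqr_ge0// exprn_ge0.
have S0 : 0 <= S by have := fS 0; rewrite big_geq.
have cvg0 : (fun n => 2 * 2^-1 ^+ n * S) @ \oo --> (0 : R).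
  rewrite -(mul0r S); apply: cvgMl; rewrite -(mulr0 2); apply: cvgMr.
  by apply: cvg_expr; rewrite ger0_norm// invf_lt1// ltr1n.
have cf : cvgn f.
  apply/cauchy_cvgP/cauchy_exP => e e0.
  have /cvgr_lt /(_ _ (exprn_gt0 2 e0))[N _ /(_ _ (leqnn N)) NS] := cvg0.
  exists (f N); exists N => // m /= Nm.
  rewrite /ball/= distrC -ltr_sqr ?nnegrE// ?ltW// real_normK ?num_real//.
  by apply: le_lt_trans NS; rewrite -(subnKC Nm).
exists (limn f) => // n.
have h : (fun m => (f m - f n) ^+ 2) @ \oo --> (limn f - f n) ^+ 2.
  by apply: cvgM; apply: cvgB => //; exact: cvg_cst.
rewrite -sqrrN opprB -(cvg_lim _ h)//; apply: limr_le; first by apply/cvg_ex; eexists; exact: h.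
by exists n => // m /= nm; rewrite -(subnKC nm).
Qed.

Lemma L2_complete (f : nat -> T -> R) :
  (forall n, measurable_fun D (f n)) ->
  (forall n, (\int[mu]_(x in D) ((f n.+1 x - f n x) ^+ 2)%:E <= ((4^-1) ^+ n)%:E)%E) ->
  exists2 v : T -> R, measurable_fun D v &
    (fun n => \int[mu]_(x in D) ((f n x - v x) ^+ 2)%:E)%E @ \oo --> 0%E.
Proof.
move=> mf intf.
pose t n x : \bar R := ((2 ^+ n * (f n.+1 x - f n x) ^+ 2)%:E).
have t0 n x : (0 <= t n x)%E.
  by rewrite lee_fin mulr_ge0 ?sqr_ge0// exprn_ge0.
have mt n : measurable_fun D (t n).
  apply/measurable_EFinP; apply: measurable_funM; first exact: measurable_cst.
  by apply: measurable_funX; exact: measurable_funB.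
pose S x := (\sum_(0 <= k <oo) t k x)%E.
have mS : measurable_fun D S.
  by apply: ge0_emeasurable_sum => // k x _ _; exact: t0.
have S0 x : (0 <= S x)%E by apply: nneseries_ge0 => k _ _; exact: t0.
have intS : (\int[mu]_(x in D) S x <= 2%:E)%E.
  rewrite integral_nneseries//.
  apply: (@le_trans _ _ (\sum_(0 <= k <oo) ((2^-1) ^+ k)%:E)%E).
    apply: lee_nneseries => [k _ _|k _].
      by apply: integral_ge0 => x _; exact: t0.
    under eq_integral do rewrite /t EFinM.
    rewrite ge0_integralZl_EFin//; last 2 first.
    - by move=> x _; rewrite lee_fin sqr_ge0.
    - by apply/measurable_EFinP; apply: measurable_funX; exact: measurable_funB.
    apply: (@le_trans _ _ ((2 ^+ k)%:E * (4^-1 ^+ k)%:E)%E).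
      by apply: lee_wpmul2l => //; rewrite lee_fin exprn_ge0.
    rewrite -EFinM lee_fin -exprMn; suff -> : 2 * 4^-1 = 2^-1 :> R by []; by field.
  apply: lime_le => //.
    by apply: is_cvg_nneseries => k _ _; rewrite lee_fin exprn_ge0.
  near=> n; rewrite sumEFin lee_fin.
  have -> : \sum_(0 <= k < n) 2^-1 ^+ k = 2 - 2 * 2^-1 ^+ n :> R.
    elim: {+}n => [|m IH]; first by rewrite big_geq// expr0; ring.
    by rewrite big_nat_recr//= IH exprS; field.
  by rewrite gerBl mulr_ge0// exprn_ge0.
have lim x : exists l, S x \is a fin_num -> f ^~ x @ \oo --> l /\
    forall n, (f n x - l) ^+ 2 <= 2 * 2^-1 ^+ n * fine (S x).
  have [Sx|_] := boolP (S x \is a fin_num); last by exists 0.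
  have [|l fl lS] := @cvg_of_sqr_series (f ^~ x) (fine (S x)); last by exists l.
  move=> n; rewrite -lee_fin fineK// -sumEFin.
  by apply: nneseries_lim_ge => k _ _; exact: t0.
have [w wP] := choice lim.
(* Where [S x = +oo] the bound [(f n x - v x) ^+ 2 <= 2 * 2^-1 ^+ n * S x] is
   trivial, so no almost-everywhere argument is needed. *)
pose v x := if S x \is a fin_num then w x else 0.
have mE : measurable_fun D (fun x => S x \is a fin_num).
  by apply: (measurable_fun_bool true); exact/emeasurable_fin_num.
have mv : measurable_fun D v.
  apply: (@measurable_fun_cvg _ _ _ _ (fun n x => if S x \is a fin_num then f n x else 0)).
  - move=> n; apply: measurable_fun_if => //.
    by apply: measurable_funS (mf n) => //; exact: subIsetl.
  - move=> x _; rewrite /v; case: ifPn => [/wP[]//|_].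
    exact: cvg_cst.
exists v => //.
have bnd n : (\int[mu]_(x in D) ((f n x - v x) ^+ 2)%:E <= (2 * 2^-1 ^+ n)%:E * 2%:E)%E.
  have c0 : 0 < 2 * 2^-1 ^+ n :> R by rewrite mulr_gt0// exprn_gt0.
  apply: (@le_trans _ _ (\int[mu]_(x in D) ((2 * 2^-1 ^+ n)%:E * S x))%E).
    apply: ge0_le_integral => //.
    - by move=> x _; rewrite lee_fin sqr_ge0.
    - by apply/measurable_EFinP; apply: measurable_funX; exact: measurable_funB.
    - exact: measurable_funeM.
    - move=> x _; rewrite /v; case: ifPn => [/[dup] Sx /wP[_ /(_ n)]|].
        by move=> wS; rewrite -[in leRHS](fineK Sx) -EFinM lee_fin.
      rewrite ge0_fin_numE// -leNgt leye_eq => /eqP ->.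
      by rewrite gt0_muley ?lte_fin// leey.
  rewrite ge0_integralZl_EFin//.
  by apply: lee_wpmul2l => //; rewrite lee_fin ltW.
apply: (@squeeze_cvge _ _ _ _ (cst 0%E) _ (fun n => (2 * 2^-1 ^+ n)%:E * 2%:E)%E).
- by near=> n; rewrite bnd andbT; apply: integral_ge0 => x _; rewrite lee_fin sqr_ge0.
- exact: cvg_cst.
under eq_fun do rewrite -EFinM; apply: cvg_EFin; first by near=> n.
rewrite /= -[X in _ --> X](mul0r 2) /comp/=; apply: cvgMl; rewrite -(mulr0 2); apply: cvgMr.
by apply: cvg_expr; rewrite ger0_norm// invf_lt1// ltr1n.
Unshelve. all: by end_near.
Qed.
End L2Complete.

(** * Extraction along an ultrafilter *)

Section UltrafilterExtraction.
Variables (R : realType) (U : set_system nat).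
Hypotheses (UU : UltraFilter U) (ooU : forall n, U [set m | (n < m)%N]).

Lemma ultra_bounded_cvg (b : nat -> R) (B : R) :
  (forall n, `|b n| <= B) -> exists l : R, b @ U --> l.
Proof.
move=> bB.
have [l [_ bl]] : (`[- B, B] `&` cluster (b @ U)) !=set0.
  apply: segment_compact.
  by apply: (@filterE _ U) => n; rewrite /= in_itv/= -ler_norml.
exists l; apply/cvgrPdist_lt => e e0.
have [//|Ue] := in_ultra_setVsetC [set n | `|l - b n| < e] UU.
have [y [+ ly]] := bl [set y | ~ `|l - y| < e] _ Ue (nbhsx_ballx l e e0).
by move/(_ ly).
Qed.

Lemma ultra_bounded_close (I : finType) (b : nat -> I -> R) (B e : R) :
  0 < e -> (forall n i, `|b n i| <= B) ->
  exists2 A, U A & forall n m, A n -> A m -> forall i, `|b n i - b m i| <= e.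
Proof.
move=> e0 bB.
have [l bl] := choice (fun i => @ultra_bounded_cvg (b ^~ i) B (bB ^~ i)).
exists [set n | forall i, `|l i - b n i| < e / 2].
  apply: filter_forall => i.
  by have /cvgrPdist_lt := bl i; apply; rewrite divr_gt0.
move=> n m /= An Am i; have := An i; have := Am i => h1 h2.
rewrite (_ : _ - _ = (l i - b m i) - (l i - b n i)); last by ring.
apply: le_trans (ler_normB _ _) _; lra.
Qed.

Lemma ultra_subsequence (P : nat -> nat -> nat -> Prop) :
  (forall k, exists2 A, U A & forall n m, A n -> A m -> P k n m) ->
  exists sigma : nat -> nat,
    (forall k, (sigma k < sigma k.+1)%N) /\
    forall k, P k (sigma k) (sigma k.+1).
Proof.
move=> PA; have [A AP] := choice (fun k => let: ex_intro2 a b c := PA k in ex_intro _ a (conj b c)).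
have next k n : exists m, (n < m)%N /\ forall i : 'I_k.+1, A i m.
  have : U ([set m | (n < m)%N] `&` [set m | forall i : 'I_k.+1, A i m]).
    by apply: filterI => //; apply: filter_forall => i; have [] := AP i.
  by move=> /filter_ex[m [? ?]]; exists m.
have [f fP] := choice (fun kn : nat * nat => next kn.1 kn.2).
pose sigma := fix s k := if k is k'.+1 then f (k, s k') else f (0%N, 0%N).
have sA k : forall i : 'I_k.+1, A i (sigma k).
  by case: k => [|k] /=; [exact: (fP (_, _)).2|exact: (fP (_, _)).2].
exists sigma; split => k; first exact: (fP (_, _)).1.
have [_] := AP k; apply; first exact: (sA k ord_max).
exact: (sA k.+1 (widen_ord (leqnSn _) ord_max)).
Qed.

End UltrafilterExtraction.

(** * Row and column energies of test functions *)

Section Energy.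
Variable R : realType.
Local Notation mu := (@lebesgue_measure R).
Local Notation I01 := (`]0%R, 1%R[%classic : set R).
Implicit Types (phi : R * R -> R) (h : R -> R).

Definition row_energy phi (y : R) : \bar R :=
  (\int[mu]_(t in I01) ((pd false phi (t, y)) ^+ 2)%:E)%E.

Definition col_energy phi (x : R) : \bar R :=
  (\int[mu]_(s in I01) ((pd true phi (x, s)) ^+ 2)%:E)%E.

Lemma row_energy_ge0 phi y : (0 <= row_energy phi y)%E.
Proof. by apply: integral_ge0 => t _; rewrite lee_fin sqr_ge0. Qed.

Lemma col_energy_ge0 phi x : (0 <= col_energy phi x)%E.
Proof. by apply: integral_ge0 => t _; rewrite lee_fin sqr_ge0. Qed.

Lemma smooth2_continuous phi : smooth2 phi -> continuous phi.
Proof. by move=> /(_ [::])[]. Qed.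

Lemma smooth2_pd_continuous b phi : smooth2 phi -> continuous (pd b phi).
Proof. by move=> /(_ [:: b])[]. Qed.

Lemma smooth2_measurable_sqr_pd b phi : smooth2 phi ->
  measurable_fun [set: R * R] (fun x => ((pd b phi x) ^+ 2)%:E).
Proof.
move=> sphi; apply/measurable_EFinP/measurable_funX.
by apply: continuous_measurable_prod; exact: smooth2_pd_continuous.
Qed.

Lemma row_increment_le phi y a b l : smooth2 phi ->
  0 <= a <= 1 -> 0 <= b <= 1 -> `|b - a| <= l ->
  (((phi (b, y) - phi (a, y)) ^+ 2)%:E <= l%:E * row_energy phi y)%E.
Proof.
move=> sphi a01 b01 abl.
apply: (@sqr_increment01_le _ (fun t => phi (t, y))) => //.
  by move=> x; exact: ((sphi [::]).2 false (x, y)).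
move=> x; apply: (@cvg_comp _ _ _ (fun t => (t, y)) (pd false phi) _ (nbhs (x, y))).
  exact: (@cvg_pair _ _ _ _ (nbhs x) (nbhs y) _ _ _ _ _ cvg_id (cvg_cst y)).
exact: (@smooth2_pd_continuous false phi sphi (x, y)).
Qed.

Lemma col_increment_le phi x a b l : smooth2 phi ->
  0 <= a <= 1 -> 0 <= b <= 1 -> `|b - a| <= l ->
  (((phi (x, b) - phi (x, a)) ^+ 2)%:E <= l%:E * col_energy phi x)%E.
Proof.
move=> sphi a01 b01 abl.
apply: (@sqr_increment01_le _ (fun t => phi (x, t))) => //.
  by move=> y; exact: ((sphi [::]).2 true (x, y)).
move=> y; apply: (@cvg_comp _ _ _ (fun t => (x, t)) (pd true phi) _ (nbhs (x, y))).
  exact: (@cvg_pair _ _ _ _ (nbhs x) (nbhs y) _ _ _ _ _ (cvg_cst x) cvg_id).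
exact: (@smooth2_pd_continuous true phi sphi (x, y)).
Qed.

Lemma Cc_inf_left_edge phi y : Cc_inf phi -> phi (0, y) = 0.
Proof.
move=> [_ [K [_ [KO ->//]]]] /KO[/=].
by rewrite in_itv/= ltxx.
Qed.

Lemma Cc_inf_sqr_le phi x y l : Cc_inf phi -> 0 <= x <= 1 -> x <= l ->
  (((phi (x, y)) ^+ 2)%:E <= l%:E * row_energy phi y)%E.
Proof.
move=> cphi /andP[x0 x1] xl; rewrite -[phi (x, y)]subr0 -(Cc_inf_left_edge y cphi).
apply: row_increment_le; rewrite ?lexx ?ler01 ?x0//; first exact: cphi.1.
by rewrite subr0 ger0_norm.
Qed.

Lemma measurable_row_energy phi : smooth2 phi -> measurable_fun setT (row_energy phi).
Proof.
move=> sphi; apply: (@measurable_tonelli_setX2 _ I01 setT (fun x => ((pd false phi x) ^+ 2)%:E)) => //.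
  exact: measurable_funS (smooth2_measurable_sqr_pd false sphi).
by move=> x _; rewrite lee_fin sqr_ge0.
Qed.

Lemma measurable_col_energy phi : smooth2 phi -> measurable_fun setT (col_energy phi).
Proof.
move=> sphi; apply: (@measurable_tonelli_setX1 _ setT I01 (fun x => ((pd true phi x) ^+ 2)%:E)) => //.
  exact: measurable_funS (smooth2_measurable_sqr_pd true sphi).
by move=> x _; rewrite lee_fin sqr_ge0.
Qed.

Lemma measurable_Omega : measurable (@Omega R).
Proof. exact: measurableX. Qed.

Lemma lebesgue_I01 : mu I01 = 1%E.
Proof. by rewrite lebesgue_measure_itv/= lte_fin ltr01 sube0. Qed.

Lemma integral_cst_I01 (r : \bar R) : (\int[mu]_(_ in I01) r)%E = r.
Proof.
rewrite integral_cst// -[RHS]mule1; congr (_ * _)%E.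
exact: lebesgue_I01.
Qed.

Lemma leb2_Omega : leb2 (@Omega R) = 1%E.
Proof.
transitivity (mu I01 * mu I01)%E; first exact: product_measure1E.
by rewrite lebesgue_I01 mule1.
Qed.

Lemma integral_row_energy phi : smooth2 phi ->
  (\int[mu]_(y in I01) row_energy phi y =
   \int[@leb2 R]_(x in @Omega R) ((pd false phi x) ^+ 2)%:E)%E.
Proof.
move=> sphi; rewrite /Omega tonelli_setX2//.
  exact: measurable_funS (smooth2_measurable_sqr_pd false sphi).
by move=> x _; rewrite lee_fin sqr_ge0.
Qed.

Lemma integral_Omega_row_energy phi : smooth2 phi ->
  (\int[@leb2 R]_(x in @Omega R) row_energy phi x.2 =
   \int[@leb2 R]_(x in @Omega R) ((pd false phi x) ^+ 2)%:E)%E.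
Proof.
move=> sphi; rewrite -integral_row_energy// /Omega tonelli_setX2//=.
- apply: eq_integral => y _.
  by rewrite integral_cst_I01.
- apply: (measurable_funS measurableT) => //.
  exact: (measurableT_comp (measurable_row_energy sphi) measurable_snd).
- by move=> x _; exact: row_energy_ge0.
Qed.

Lemma measurable_Omega_fst h : measurable_fun I01 h ->
  measurable_fun (@Omega R) (h \o fst).
Proof.
move=> mh; apply: (measurable_comp (F := I01)) => //.
- by move=> _ [x [x1 _] <-].
- exact: measurable_funS measurable_fst.
Qed.

Lemma measurable_Omega_col_energy h phi : smooth2 phi -> measurable_fun I01 h ->
  measurable_fun (@Omega R) (fun x => (h x.1)%:E * col_energy phi x.1)%E.
Proof.
move=> sphi mh; apply: emeasurable_funM.
  by apply/measurable_EFinP; exact: measurable_Omega_fst.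
apply: (measurable_funS measurableT) => //.
exact: (measurableT_comp (measurable_col_energy sphi) measurable_fst).
Qed.

Lemma integral_Omega_col_energy h phi : smooth2 phi ->
  measurable_fun I01 h -> (forall t, I01 t -> 0 <= h t) ->
  (\int[@leb2 R]_(x in @Omega R) ((h x.1)%:E * col_energy phi x.1) =
   \int[@leb2 R]_(x in @Omega R) ((Num.sqrt (h x.1) * pd true phi x) ^+ 2)%:E)%E.
Proof.
move=> sphi mh h0.
have mh1 := measurable_Omega_fst mh.
have msqrt : measurable_fun (@Omega R) (fun x => ((Num.sqrt (h x.1) * pd true phi x) ^+ 2)%:E).
  apply/measurable_EFinP/measurable_funX/measurable_funM.
    exact: measurableT_comp (continuous_measurable_fun (@sqrt_continuous R)) mh1.
  apply: (measurable_funS measurableT) => //.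
  by apply: continuous_measurable_prod; exact: smooth2_pd_continuous.
rewrite /Omega tonelli_setX1//; last first.
- by move=> x [/h0 h1 _]; rewrite mule_ge0 ?col_energy_ge0 ?lee_fin.
- exact: measurable_Omega_col_energy.
rewrite tonelli_setX1//; last first.
- by move=> x _; rewrite lee_fin sqr_ge0.
apply: eq_integral => x /[!inE] /h0 hx /=.
rewrite integral_cst_I01.
under [RHS]eq_integral do rewrite exprMn sqr_sqrtr// EFinM.
rewrite ge0_integralZl_EFin//.
  by move=> y _; rewrite lee_fin sqr_ge0.
apply: (measurable_funS measurableT) => //.
exact: measurableT_comp (smooth2_measurable_sqr_pd true sphi) (pair1_measurable x).
Qed.
End Energy.

Section Sampling.
Variable R : realType.
Local Notation mu := (@lebesgue_measure R).
Local Notation I01 := (`]0%R, 1%R[%classic : set R).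
Implicit Types (phi : R * R -> R) (M : R).

Lemma unit_interval_cell (n : nat) (t : R) : (0 < n)%N -> 0 < t < 1 ->
  exists i : 'I_n, i%:R / n%:R <= t <= i.+1%:R / n%:R.
Proof.
move=> n0 /andP[t0 t1].
have n0' : 0 < n%:R :> R by rewrite ltr0n.
have tn0 : 0 <= t * n%:R by rewrite mulr_ge0// ltW.
have /andP[lo hi] := truncn_itv tn0.
have iN : (Num.truncn (t * n%:R) < n)%N.
  by rewrite -(ltr_nat R); apply: le_lt_trans lo _; rewrite gtr_pMl.
exists (Ordinal iN) => /=.
by rewrite ler_pdivrMr// ler_pdivlMr// lo ltW.
Qed.

Lemma cell_width (n i : nat) (a b : R) :
  i%:R / n%:R <= a <= i.+1%:R / n%:R -> i%:R / n%:R <= b <= i.+1%:R / n%:R ->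
  `|b - a| <= n%:R^-1.
Proof.
have -> : i.+1%:R / n%:R = i%:R / n%:R + n%:R^-1 :> R by rewrite -natr1 mulrDl mul1r.
move=> /andP[? ?] /andP[? ?]; rewrite ler_distl; apply/andP; split; lra.
Qed.

Lemma cell_sub_unit_interval (n i : nat) (a : R) : (i < n)%N ->
  i%:R / n%:R <= a <= i.+1%:R / n%:R -> 0 <= a <= 1.
Proof.
move=> ni /andP[ia ai]; apply/andP; split.
  by apply: le_trans ia; rewrite divr_ge0.
apply: le_trans ai _; rewrite ler_pdivrMr ?mul1r ?ler_nat// ltr0n.
exact: leq_ltn_trans ni.
Qed.

(* Chebyshev: the row energies average to at most [M], so each band of height
   [1/n] contains a row of energy at most [(M + 1) n]. *)
Lemma low_energy_row phi M (n : nat) (i : 'I_n) : smooth2 phi ->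
  (\int[@leb2 R]_(x in @Omega R) ((pd false phi x) ^+ 2)%:E <= M%:E)%E ->
  exists y : R, i%:R / n%:R <= y <= i.+1%:R / n%:R /\
    (row_energy phi y <= ((M + 1) * n%:R)%:E)%E.
Proof.
move=> sphi phiM; apply: contrapT => /forallNP noy.
have n0 : (0 < n)%N by exact: leq_ltn_trans (ltn_ord i).
have n0' : 0 < n%:R :> R by rewrite ltr0n.
pose J : set R := `]i%:R / n%:R, i.+1%:R / n%:R[%classic.
have mrow : measurable_fun I01 (row_energy phi).
  exact: measurable_funS (measurable_row_energy sphi).
have mJ : measurable J by exact: measurable_itv.
have JI : J `<=` I01.
  move=> y; rewrite /J /= !in_itv/= => /andP[iy yi]; apply/andP; split.
    by apply: le_lt_trans iy; rewrite divr_ge0.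
  by apply: lt_le_trans yi _; rewrite ler_pdivrMr// mul1r ler_nat.
have M0 : 0 <= M.
  rewrite -lee_fin; apply: le_trans phiM.
  by apply: integral_ge0 => x _; rewrite lee_fin sqr_ge0.
have muJ : mu J = (n%:R^-1)%:E.
  rewrite /J lebesgue_measure_itv/= lte_fin ltr_pM2r ?invr_gt0// ltr_nat ltnSn.
  by rewrite -EFinB -mulrBl -natr1 addrAC subrr add0r mul1r.
have : ((M + 1)%:E <= M%:E)%E.
  apply: le_trans phiM; rewrite -integral_row_energy//.
  apply: (@le_trans _ _ (\int[mu]_(y in J) row_energy phi y)%E); last first.
    by apply: ge0_subset_integral => // y _; exact: row_energy_ge0.
  apply: (@le_trans _ _ (\int[mu]_(y in J) (cst ((M + 1) * n%:R)%:E y))%E).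
    rewrite integral_cst//.
    rewrite [X in (_ * X)%E](_ : _ = (n%:R^-1)%:E)//.
    by rewrite -EFinM mulfK ?gt_eqF.
  apply: ge0_le_integral => //.
  - by move=> y _; rewrite lee_fin mulr_ge0// addr_ge0.
  - exact: (measurable_funS _ JI mrow).
  - move=> y; rewrite /J /= in_itv/= => /andP[iy yi].
    rewrite leNgt; apply/negP => /ltW yM; apply: (noy y).
    by split=> //; apply/andP; split; exact: ltW.
by rewrite lee_fin gerDl ler10.
Qed.

Lemma sampling_error phi M (n : nat) (i : 'I_(n * n)) (j : 'I_n) (x : R * R) (y2 : R) :
  smooth2 phi ->
  i%:R / (n * n)%:R <= x.1 <= i.+1%:R / (n * n)%:R ->
  j%:R / n%:R <= x.2 <= j.+1%:R / n%:R ->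
  j%:R / n%:R <= y2 <= j.+1%:R / n%:R ->
  (row_energy phi y2 <= ((M + 1) * n%:R)%:E)%E ->
  (((phi x - phi (i%:R / (n * n)%:R, y2)) ^+ 2)%:E <=
    (2 / n%:R)%:E * col_energy phi x.1 + (2 * (M + 1) / n%:R)%:E)%E.
Proof.
case: x => x1 x2 /= sphi xi xj yj rowM.
have n0 : (0 < n)%N by exact: leq_ltn_trans (ltn_ord j).
have n0' : 0 < n%:R :> R by rewrite ltr0n.
set y1 := i%:R / (n * n)%:R.
have yi : i%:R / (n * n)%:R <= y1 <= i.+1%:R / (n * n)%:R.
  by rewrite lexx ler_wpM2r ?invr_ge0// ler_nat.
have := col_increment_le x1 sphi (cell_sub_unit_interval (ltn_ord j) yj)
   (cell_sub_unit_interval (ltn_ord j) xj) (cell_width yj xj).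
have := row_increment_le y2 sphi (cell_sub_unit_interval (ltn_ord i) yi)
   (cell_sub_unit_interval (ltn_ord i) xi) (cell_width yi xi).
move=> row_le col_le.
have {}row_le : (phi (x1, y2) - phi (y1, y2)) ^+ 2 <= (M + 1) / n%:R.
  rewrite -lee_fin; apply: le_trans row_le _.
  apply: (le_trans (lee_wpmul2l _ rowM)); first by rewrite lee_fin invr_ge0.
  by rewrite -EFinM lee_fin natrM invfM le_eqVlt; apply/orP; left; apply/eqP; field; exact: lt0r_neq0.
apply: (@le_trans _ _ ((2 * (phi (x1, x2) - phi (x1, y2)) ^+ 2)%:E +
    (2 * (phi (x1, y2) - phi (y1, y2)) ^+ 2)%:E)%E).
  rewrite -EFinD lee_fin -subr_ge0.
  have := sqr_ge0 ((phi (x1, x2) - phi (x1, y2)) - (phi (x1, y2) - phi (y1, y2))).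
  by congr (0 <= _); ring.
apply: leeD.
  rewrite !EFinM -muleA; apply: lee_wpmul2l => //.
by rewrite lee_fin -mulrA ler_pM2l.
Qed.

End Sampling.

(** * Total boundedness in L2 *)

Section TotalBoundedness.
Variable R : realType.
Local Notation I01 := (`]0%R, 1%R[%classic : set R).
Variables (h : R -> R) (M : R).
Hypothesis mh : measurable_fun I01 h.
Hypothesis h0 : forall t, I01 t -> 0 <= h t.

Lemma sqr_dist_le_energies (d c K N hx fx gx p q : R) (rf rg cf cg : \bar R) :
  0 < d -> 0 < c -> 0 <= K -> 1 <= N -> 0 <= hx ->
  (0 <= rf)%E -> (0 <= rg)%E -> (0 <= cf)%E -> (0 <= cg)%E ->
  `|p - q| <= N^-1 ->
  ((fx ^+ 2)%:E <= d%:E * rf)%E /\ ((gx ^+ 2)%:E <= d%:E * rg)%E \/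
  [/\ c <= hx, (((fx - p) ^+ 2)%:E <= (2 / N)%:E * cf + (K / N)%:E)%E &
    (((gx - q) ^+ 2)%:E <= (2 / N)%:E * cg + (K / N)%:E)%E] ->
  (((fx - gx) ^+ 2)%:E <= (2 * d)%:E * (rf + rg) +
    (6 / N / c)%:E * (hx%:E * cf + hx%:E * cg) + ((6 * K + 3) / N)%:E)%E.
Proof.
move=> d0 c0 K0 N1 hx0 rf0 rg0 cf0 cg0 pq.
have N0 : 0 < N by exact: lt_le_trans N1.
have KN0 : 0 <= K / N by rewrite divr_ge0// ltW.
have hE (a : \bar R) : (0 <= a)%E -> (0 <= hx%:E * a)%E.
  by move=> a0; apply: mule_ge0; rewrite ?lee_fin.
have B0 : (0 <= (6 / N / c)%:E * (hx%:E * cf + hx%:E * cg))%E.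
  apply: mule_ge0; first by rewrite lee_fin !divr_ge0// ltW.
  by apply: adde_ge0; exact: hE.
case=> [[f_le g_le]|[hcx f_le g_le]].
  apply: (@le_trans _ _ ((2 * d)%:E * (rf + rg))%E).
    apply: (@le_trans _ _ (2%:E * ((fx ^+ 2)%:E + (gx ^+ 2)%:E))%E).
      rewrite -EFinD -EFinM lee_fin -subr_ge0; have := sqr_ge0 (fx + gx).
      by congr (0 <= _); ring.
    rewrite (EFinM 2 d) -muleA; apply: lee_wpmul2l; first by rewrite lee_fin.
    by rewrite ge0_muleDr//; apply: leeD.
  rewrite -[leRHS]addeA; apply: leeDl; apply: adde_ge0 => //.
  by rewrite lee_fin divr_ge0 ?(ltW N0)// addr_ge0// mulr_ge0.
have pq2 : (p - q) ^+ 2 <= N^-1.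
  have N1' : N^-1 <= 1 by rewrite invf_le1.
  rewrite -real_normK ?num_real// expr2.
  apply: le_trans (ler_pM _ _ pq pq) _ => //.
  by rewrite ler_piMl// invr_ge0 ltW.
have sqr3 : (fx - gx) ^+ 2 <= 3 * (fx - p) ^+ 2 + 3 * (gx - q) ^+ 2 + 3 / N.
  apply: (@le_trans _ _ (3 * (fx - p) ^+ 2 + 3 * (gx - q) ^+ 2 + 3 * (p - q) ^+ 2)); last first.
    by rewrite lerD2l ler_pM2l.
  have -> : fx - gx = (fx - p) - (gx - q) + (p - q) by ring.
  set a := fx - p; set b := gx - q; set e := p - q; rewrite -subr_ge0.
  have : 0 <= (a + b) ^+ 2 + (b + e) ^+ 2 + (a - e) ^+ 2 by rewrite !addr_ge0 ?sqr_ge0.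
  by congr (0 <= _); ring.
have part (z : R) (a : \bar R) : (0 <= a)%E -> (z%:E <= (2 / N)%:E * a + (K / N)%:E)%E ->
    ((3 * z)%:E <= (6 / N / c)%:E * (hx%:E * a) + (3 * (K / N))%:E)%E.
  move=> a0 za; rewrite (EFinM 3 z).
  apply: (le_trans (lee_wpmul2l _ za)); first by rewrite lee_fin.
  rewrite ge0_muleDr ?lee_fin//; last first.
    by apply: mule_ge0; rewrite ?lee_fin// divr_ge0// ltW.
  rewrite -(EFinM 3); apply: leeD2r.
  rewrite !muleA -!EFinM; apply: lee_wpmul2r => //; rewrite lee_fin.
  have -> : 3 * (2 / N) = 6 / N / c * c by field; rewrite !lt0r_neq0.
  by rewrite ler_wpM2l// !divr_ge0// ltW.
have h1 := part _ _ cf0 f_le; have h2 := part _ _ cg0 g_le.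
apply: (@le_trans _ _ (((3 * (fx - p) ^+ 2)%:E + (3 * (gx - q) ^+ 2)%:E) + (3 / N)%:E)%E).
  by rewrite -!EFinD lee_fin.
apply: (le_trans (leeD2r _ (leeD h1 h2))).
rewrite addeACA -ge0_muleDr; [|exact: hE|exact: hE].
rewrite -!addeA -[leLHS]add0e; apply: leeD.
  apply: mule_ge0; first by rewrite lee_fin mulr_ge0// ltW.
  exact: adde_ge0.
apply: leeD2l; rewrite -!EFinD lee_fin le_eqVlt; apply/orP; left; apply/eqP.
by field; rewrite lt0r_neq0.
Qed.

Lemma sampled_sqr_dist_le (phi psi : R * R -> R) (n : nat) (d c : R)
    (r s : 'I_n -> R) (x : R * R) :
  Cc_inf phi -> Cc_inf psi -> 0 <= M -> 0 < c ->
  (forall t, d <= t < 1 -> c <= h t) ->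
  (forall j : 'I_n, j%:R / n%:R <= r j <= j.+1%:R / n%:R /\
    (row_energy phi (r j) <= ((M + 1) * n%:R)%:E)%E) ->
  (forall j : 'I_n, j%:R / n%:R <= s j <= j.+1%:R / n%:R /\
    (row_energy psi (s j) <= ((M + 1) * n%:R)%:E)%E) ->
  (forall (i : 'I_(n * n)) (j : 'I_n), `|phi (i%:R / (n * n)%:R, r j)
     - psi (i%:R / (n * n)%:R, s j)| <= n%:R^-1) ->
  (0 < n)%N -> 0 < d -> @Omega R x ->
  (((phi x - psi x) ^+ 2)%:E <=
    (2 * d)%:E * (row_energy phi x.2 + row_energy psi x.2) +
    (6 / n%:R / c)%:E * ((h x.1)%:E * col_energy phi x.1 +
                         (h x.1)%:E * col_energy psi x.1) +
    ((6 * (2 * (M + 1)) + 3) / n%:R)%:E)%E.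
Proof.
move=> cphi cpsi M0 c0 hc rP sP close n0 d0 [/=].
rewrite !in_itv/= => x1I x2I.
have nn0 : (0 < n * n)%N by rewrite muln_gt0 n0.
have [i xi] := unit_interval_cell nn0 x1I.
have [j xj] := unit_interval_cell n0 x2I.
apply: (sqr_dist_le_energies d0 c0 _ _ _ _ _ _ _ (close i j)).
- by rewrite mulr_ge0// addr_ge0.
- by rewrite ler1n.
- by apply: h0; rewrite /= in_itv.
- exact: row_energy_ge0.
- exact: row_energy_ge0.
- exact: col_energy_ge0.
- exact: col_energy_ge0.
have [x1d|dx1] := leP x.1 d; [left|right].
  have x1I' : 0 <= x.1 <= 1 by case/andP: x1I => *; rewrite !ltW.
  have := Cc_inf_sqr_le x.2 cphi x1I' x1d; have := Cc_inf_sqr_le x.2 cpsi x1I' x1d.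
  by rewrite -surjective_pairing => g_le f_le; split; [exact: f_le|exact: g_le].
split.
- by apply: hc; rewrite (ltW dx1); case/andP: x1I.
- exact: sampling_error cphi.1 xi xj (rP j).1 (rP j).2.
- exact: sampling_error cpsi.1 xi xj (sP j).1 (sP j).2.
Qed.

Lemma integral_sqr_dist_le (phi psi : R * R -> R) (A B K : R) :
  Cc_inf phi -> Cc_inf psi -> 0 <= A -> 0 <= B -> 0 <= K ->
  (\int[@leb2 R]_(x in @Omega R) ((pd false phi x) ^+ 2)%:E <= M%:E)%E ->
  (\int[@leb2 R]_(x in @Omega R) ((pd false psi x) ^+ 2)%:E <= M%:E)%E ->
  (\int[@leb2 R]_(x in @Omega R) ((Num.sqrt (h x.1) * pd true phi x) ^+ 2)%:E <= M%:E)%E ->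
  (\int[@leb2 R]_(x in @Omega R) ((Num.sqrt (h x.1) * pd true psi x) ^+ 2)%:E <= M%:E)%E ->
  (forall x, @Omega R x -> (((phi x - psi x) ^+ 2)%:E <=
    A%:E * (row_energy phi x.2 + row_energy psi x.2) +
    B%:E * ((h x.1)%:E * col_energy phi x.1 +
                         (h x.1)%:E * col_energy psi x.1) + K%:E)%E) ->
  (\int[@leb2 R]_(x in @Omega R) ((phi x - psi x) ^+ 2)%:E <=
    (A * (2 * M) + B * (2 * M) + K)%:E)%E.
Proof.
move=> cphi cpsi A0 B0 K0 phi1 psi1 phi2 psi2 le_pt.
have mO := @measurable_Omega R.
have sphi := cphi.1; have spsi := cpsi.1.
have mrow f : smooth2 f -> measurable_fun (@Omega R) (fun x => row_energy f x.2).
  move=> sf; apply: (measurable_funS measurableT) => //.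
  exact: (measurableT_comp (measurable_row_energy sf) measurable_snd).
have mcol f : smooth2 f -> measurable_fun (@Omega R) (fun x => (h x.1)%:E * col_energy f x.1)%E.
  by move=> sf; exact: measurable_Omega_col_energy.
have row0 f x : @Omega R x -> (0 <= row_energy f x.2)%E by move=> _; exact: row_energy_ge0.
have col0 f x : @Omega R x -> (0 <= (h x.1)%:E * col_energy f x.1)%E.
  by move=> [x1 _]; rewrite mule_ge0 ?col_energy_ge0// lee_fin h0.
have mrows : measurable_fun (@Omega R) (fun x => row_energy phi x.2 + row_energy psi x.2)%E.
  by apply: emeasurable_funD; exact: mrow.
have mcols : measurable_fun (@Omega R) (fun x => (h x.1)%:E * col_energy phi x.1 +
                         (h x.1)%:E * col_energy psi x.1)%E.
  by apply: emeasurable_funD; exact: mcol.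
have rows0 x : @Omega R x -> (0 <= row_energy phi x.2 + row_energy psi x.2)%E.
  by move=> Ox; rewrite adde_ge0 ?row0.
have cols0 x : @Omega R x -> (0 <= (h x.1)%:E * col_energy phi x.1 +
                         (h x.1)%:E * col_energy psi x.1)%E.
  by move=> Ox; rewrite adde_ge0 ?col0.
apply: (le_trans (@ge0_le_integral _ _ _ (@leb2 R) _ mO _ _ _ _ _ le_pt)).
- by move=> x _; rewrite lee_fin sqr_ge0.
- apply/measurable_EFinP/measurable_funX/measurable_funB;
  apply: (measurable_funS measurableT) => //; apply: continuous_measurable_prod; exact: smooth2_continuous.
- apply: emeasurable_funD => //; apply: emeasurable_funD; exact: measurable_funeM.
rewrite ge0_integralD//; last 2 first.
- by move=> x Ox; rewrite adde_ge0// mule_ge0 ?lee_fin ?rows0 ?cols0.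
- by apply: emeasurable_funD; exact: measurable_funeM.
rewrite ge0_integralD//; last 4 first.
- by move=> x Ox; rewrite mule_ge0 ?lee_fin ?rows0.
- exact: measurable_funeM.
- by move=> x Ox; rewrite mule_ge0 ?lee_fin ?cols0.
- exact: measurable_funeM.
have intA : (\int[@leb2 R]_(x in @Omega R) (A%:E * (row_energy phi x.2 + row_energy psi x.2)) =
    A%:E * \int[@leb2 R]_(x in @Omega R) (row_energy phi x.2 + row_energy psi x.2))%E.
  by apply: ge0_integralZl_EFin; [exact: mO|exact: rows0|exact: mrows|exact: A0].
have intB : (\int[@leb2 R]_(x in @Omega R) (B%:E * ((h x.1)%:E * col_energy phi x.1 +
                         (h x.1)%:E * col_energy psi x.1)) =
    B%:E * \int[@leb2 R]_(x in @Omega R) ((h x.1)%:E * col_energy phi x.1 +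
                         (h x.1)%:E * col_energy psi x.1))%E.
  by apply: ge0_integralZl_EFin; [exact: mO|exact: cols0|exact: mcols|exact: B0].
rewrite intA intB.
have rowI f : smooth2 f -> (\int[@leb2 R]_(x in @Omega R) ((pd false f x) ^+ 2)%:E <= M%:E ->
    \int[@leb2 R]_(x in @Omega R) row_energy f x.2 <= M%:E)%E.
  by move=> sf; rewrite integral_Omega_row_energy.
have colI f : smooth2 f ->
    (\int[@leb2 R]_(x in @Omega R) ((Num.sqrt (h x.1) * pd true f x) ^+ 2)%:E <= M%:E ->
    \int[@leb2 R]_(x in @Omega R) ((h x.1)%:E * col_energy f x.1) <= M%:E)%E.
  by move=> sf; rewrite integral_Omega_col_energy.
have rowsI : (\int[@leb2 R]_(x in @Omega R) (row_energy phi x.2 + row_energy psi x.2) <= (2 * M)%:E)%E.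
  have -> := ge0_integralD (@leb2 R) mO (@row0 phi) (mrow _ sphi) (@row0 psi) (mrow _ spsi).
  by rewrite mulr_natl mulr2n EFinD; apply: leeD; [exact: rowI sphi phi1|exact: rowI spsi psi1].
have colsI : (\int[@leb2 R]_(x in @Omega R) ((h x.1)%:E * col_energy phi x.1 +
                         (h x.1)%:E * col_energy psi x.1) <= (2 * M)%:E)%E.
  have -> := ge0_integralD (@leb2 R) mO (@col0 phi) (mcol _ sphi) (@col0 psi) (mcol _ spsi).
  by rewrite mulr_natl mulr2n EFinD; apply: leeD; [exact: colI sphi phi2|exact: colI spsi psi2].
have KI : (\int[@leb2 R]_(x in @Omega R) K%:E = K%:E)%E.
  rewrite integral_cst// -[RHS]mule1; congr (_ * _)%E; exact: leb2_Omega.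
rewrite KI !EFinD (EFinM A) (EFinM B); apply: leeD2r.
apply: leeD; (apply: lee_wpmul2l; first by rewrite lee_fin).
  exact: rowsI.
exact: colsI.
Qed.
End TotalBoundedness.

Section TotalBoundednessOfSequences.
Variable R : realType.
Local Notation I01 := (`]0%R, 1%R[%classic : set R).
Local Notation Om := (@Omega R).
Local Notation l2 := (@leb2 R).

Lemma ultra_total_bounded (U : set_system nat) (h : R -> R) (M e : R)
    (phi : nat -> R * R -> R) : UltraFilter U ->
  measurable_fun I01 h -> (forall t, I01 t -> 0 <= h t) ->
  (forall d, 0 < d -> exists2 c, 0 < c & forall t, d <= t < 1 -> c <= h t) ->
  (forall n, Cc_inf (phi n)) ->
  (forall n, \int[l2]_(x in Om) ((pd false (phi n) x) ^+ 2)%:E <= M%:E)%E ->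
  (forall n, \int[l2]_(x in Om) ((Num.sqrt (h x.1) * pd true (phi n) x) ^+ 2)%:E <= M%:E)%E ->
  0 < e ->
  exists2 A, U A & forall n m, A n -> A m ->
    (\int[l2]_(x in Om) ((phi n x - phi m x) ^+ 2)%:E <= e%:E)%E.
Proof.
move=> UU mh h0 hlow cphi phi1 phi2 e0.
have M0 : 0 <= M.
  rewrite -lee_fin; apply: le_trans (phi1 0%N).
  by apply: integral_ge0 => x _; rewrite lee_fin sqr_ge0.
pose d := e / (8 * (M + 1)).
have M1 : 0 < M + 1 by rewrite ltr_wpDl.
have d0 : 0 < d by rewrite divr_gt0// mulr_gt0.
have [c c0 hc] := hlow d d0.
pose K := 6 / c * (2 * M) + (6 * (2 * (M + 1)) + 3).
have K0 : 0 <= K.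
  have c0' : 0 <= c^-1 by rewrite invr_ge0 ltW.
  have : 0 <= c^-1 * M by rewrite mulr_ge0.
  by rewrite /K; set z := c^-1 * M => z0; have -> : 6 / c * (2 * M) = 12 * z;
    [rewrite /z; ring|lra].
pose n := (Num.truncn (2 * K / e)).+1.
have Kn : 2 * K / e < n%:R by exact: truncnS_gt.
have n0 : 0 < n%:R :> R by rewrite ltr0n.
have rows k : exists r : 'I_n -> R, forall j : 'I_n, j%:R / n%:R <= r j <= j.+1%:R / n%:R /\
    (row_energy (phi k) (r j) <= ((M + 1) * n%:R)%:E)%E.
  have [r rP] := choice (fun j : 'I_n => low_energy_row j (cphi k).1 (phi1 k)).
  by exists r.
have [s sP] := choice rows.
pose b k (ij : 'I_(n * n) * 'I_n) := phi k (ij.1%:R / (n * n)%:R, s k ij.2).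
have bB k ij : `|b k ij| <= (M + 1) * n%:R + 1.
  set B := (M + 1) * n%:R.
  have B0 : 0 <= B by rewrite mulr_ge0// ltW.
  have : b k ij ^+ 2 <= B.
    rewrite -lee_fin; apply: le_trans (sP k ij.2).2; rewrite -[leRHS]mul1e.
    have ij1 : 0 <= (ij.1%:R / (n * n)%:R : R) <= 1.
      apply/andP; split; first by rewrite divr_ge0.
      by rewrite ler_pdivrMr ?mul1r ?ler_nat ?ltr0n// ltnW.
    by apply: Cc_inf_sqr_le => //; case/andP: ij1.
  rewrite -(real_normK (num_real _)); move: (normr_ge0 (b k ij)).
  move: `|b k ij| => z z0 zB; rewrite leNgt; apply/negP => Bz.
  by have : B + 1 < z ^+ 2; [nra|lra].
have ni0 : 0 < n%:R^-1 :> R by rewrite invr_gt0.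
have [A UA AP] := ultra_bounded_close UU ni0 bB.
exists A => // k m Ak Am.
have close (i : 'I_(n * n)) (j : 'I_n) : `|phi k (i%:R / (n * n)%:R, s k j)
     - phi m (i%:R / (n * n)%:R, s m j)| <= n%:R^-1 by exact: AP k m Ak Am (i, j).
have le_pt x := sampled_sqr_dist_le h0 (cphi k) (cphi m) M0 c0 hc (sP k) (sP m) close (ltn0Sn _) d0 (x := x).
apply: (le_trans (integral_sqr_dist_le mh h0 (cphi k) (cphi m) _ _ _ (phi1 k) (phi1 m) (phi2 k) (phi2 m) le_pt)).
- by rewrite mulr_ge0// ltW.
- by rewrite !divr_ge0// ltW.
- by rewrite divr_ge0 ?(ltW n0)// addr_ge0// !mulr_ge0// ltW.
rewrite lee_fin.
have -> : 2 * d * (2 * M) + 6 / n%:R / c * (2 * M) + (6 * (2 * (M + 1)) + 3) / n%:R =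
  4 * d * M + K / n%:R by rewrite /K; field; rewrite !lt0r_neq0.
have h1 : 4 * d * M <= e / 2.
  rewrite [leRHS](_ : _ = 4 * d * (M + 1)); last by rewrite /d; field; rewrite lt0r_neq0.
  by rewrite ler_wpM2l ?lerDl// mulr_ge0// ltW.
have h2 : K / n%:R <= e / 2.
  rewrite ler_pdivrMr//; move: Kn; rewrite ltr_pdivrMr// => Kn; lra.
lra.
Qed.

Lemma integral_sqr_triangle (f g : R * R -> R) :
  measurable_fun Om f -> measurable_fun Om g ->
  (\int[l2]_(x in Om) ((f x) ^+ 2)%:E <=
    2%:E * \int[l2]_(x in Om) ((f x - g x) ^+ 2)%:E +
    2%:E * \int[l2]_(x in Om) ((g x) ^+ 2)%:E)%E.
Proof.
move=> mf mg; have mO := @measurable_Omega R.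
have sq0 (k : R * R -> R) x : Om x -> (0 <= ((k x) ^+ 2)%:E)%E.
  by rewrite lee_fin sqr_ge0.
have msq (k : R * R -> R) : measurable_fun Om k -> measurable_fun Om (fun x => ((k x) ^+ 2)%:E).
  by move=> mk; apply/measurable_EFinP; exact: measurable_funX.
have mfg : measurable_fun Om (fun x => f x - g x) by exact: measurable_funB.
have intZ (k : R * R -> R) : measurable_fun Om k -> (2%:E * \int[l2]_(x in Om) ((k x) ^+ 2)%:E =
    \int[l2]_(x in Om) (2%:E * ((k x) ^+ 2)%:E))%E.
  by move=> mk; apply/esym/ge0_integralZl_EFin; [exact: mO|exact: sq0|exact: msq|].
rewrite (intZ _ mfg) (intZ _ mg) -ge0_integralD//; last 4 first.
- by move=> x _; rewrite -EFinM lee_fin mulr_ge0// sqr_ge0.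
- by apply: measurable_funeM; exact: msq.
- by move=> x _; rewrite -EFinM lee_fin mulr_ge0// sqr_ge0.
- by apply: measurable_funeM; exact: msq.
apply: ge0_le_integral => //; [exact: sq0|exact: msq| |].
  by apply: emeasurable_funD; apply: measurable_funeM; exact: msq.
move=> x _; rewrite -!EFinM -EFinD lee_fin -subr_ge0.
have := sqr_ge0 ((f x - g x) - g x); by congr (0 <= _); ring.
Qed.

Lemma Cc_inf_approx (h : R -> R) (u g1 g2 : R * R -> R) (M e : R) :
  measurable_fun I01 h ->
  H1h0_wit h u g1 g2 -> (H1h_norm2 h u g1 g2 <= M%:E)%E -> 0 < e ->
  exists phi : R * R -> R, [/\ Cc_inf phi,
    (\int[l2]_(x in Om) ((phi x - u x) ^+ 2)%:E <= e%:E)%E,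
    (\int[l2]_(x in Om) ((pd false phi x) ^+ 2)%:E <= (2 * e + 2 * M)%:E)%E &
    (\int[l2]_(x in Om) ((Num.sqrt (h x.1) * pd true phi x) ^+ 2)%:E <= (2 * e + 2 * M)%:E)%E].
Proof.
move=> mh [[Lu [Lg1 [mg2 [Lg2 _]]]] [phi [cphi phiu]]] uM e0.
have [k _ /(_ k (leqnn k)) phike] : \forall k \near \oo, ((H1h_norm2 h (fun x => phi k x - u x)
                (fun x => pd false (phi k) x - g1 x)
                (fun x => pd true (phi k) x - g2 x))%R < e%:E)%E.
  exact: phiu _ (@nbhs_open_ereal_lt R 0 (fun=> e) e0).
have mpd b : measurable_fun Om (pd b (phi k)).
  apply: (measurable_funS measurableT) => //; apply: continuous_measurable_prod.
  exact: smooth2_pd_continuous (cphi k).1.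
have msq : measurable_fun Om (fun x => Num.sqrt (h x.1)).
  exact: measurableT_comp (continuous_measurable_fun (@sqrt_continuous R)) (measurable_Omega_fst mh).
have int0 (f : R * R -> R) : (0 <= \int[l2]_(x in Om) ((f x) ^+ 2)%:E)%E.
  by apply: integral_ge0 => x _; rewrite lee_fin sqr_ge0.
move: (ltW phike) uM; rewrite /H1h_norm2 => phie uM.
have term1 (a b c : \bar R) r : (0 <= a -> 0 <= b -> 0 <= c -> a + b + c <= r -> a <= r)%E.
  move=> a0 b0 c0; apply: le_trans; rewrite -[leRHS]addeA.
  by apply: leeDl; exact: adde_ge0.
have term2 (a b c : \bar R) r : (0 <= a -> 0 <= b -> 0 <= c -> a + b + c <= r -> b <= r)%E.
  move=> a0 b0 c0; apply: le_trans; rewrite [leRHS]addeAC.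
  by apply: leeDr; exact: adde_ge0.
have term3 (a b c : \bar R) r : (0 <= a -> 0 <= b -> 0 <= c -> a + b + c <= r -> c <= r)%E.
  by move=> a0 b0 c0; apply: le_trans; apply: leeDr; exact: adde_ge0.
exists (phi k); split.
- exact: cphi.
- exact: (term1 _ _ _ _ (int0 _) (int0 _) (int0 _) phie).
- apply: (le_trans (integral_sqr_triangle (mpd false) Lg1.1)).
  rewrite (EFinD (2 * e)) (EFinM 2 e) (EFinM 2 M); apply: leeD; (apply: lee_wpmul2l; first by rewrite lee_fin).
    exact: (term2 _ _ _ _ (int0 _) (int0 _) (int0 _) phie).
  exact: (term2 _ _ _ _ (int0 _) (int0 _) (int0 _) uM).
- apply: (le_trans (integral_sqr_triangle (measurable_funM msq (mpd true)) Lg2.1)).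
  rewrite (EFinD (2 * e)) (EFinM 2 e) (EFinM 2 M); apply: leeD; (apply: lee_wpmul2l; first by rewrite lee_fin).
    under eq_integral do rewrite -mulrBr.
    exact: (term3 _ _ _ _ (int0 _) (int0 _) (int0 _) phie).
  exact: (term3 _ _ _ _ (int0 _) (int0 _) (int0 _) uM).
Qed.

End TotalBoundednessOfSequences.

(** * The coefficient h away from 0 *)

Section CoefficientRegularity.
Variables (R : realType) (h : R -> R).

Lemma continuous_within_of_quotient (A : set R) :
  (forall t, A t -> exists l : R,
    (fun s => (h s - h t) / (s - t)) @ within (A `\ t) (nbhs t) --> l) ->
  {within A, continuous h}.
Proof.
move=> dq; apply/subspace_continuousP => t At.
have [l hl] := dq t At.
have L0 : 0 < `|l| + 1 by rewrite ltr_wpDl.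
have : \forall s \near within (A `\ t) (nbhs t), `|(h s - h t) / (s - t)| < `|l| + 1.
  have /cvgrPdist_lt /(_ 1 ltr01) := hl.
  apply: filterS => s /= ls.
  rewrite -[_ / _](subrK l) addrC; apply: le_lt_trans (ler_normD _ _) _.
  by rewrite ltrD2l distrC.
rewrite near_withinE => near_q.
apply/cvgrPdist_lt => e e0; rewrite near_withinE.
have st : \forall s \near t, `|t - s| < e / (`|l| + 1).
  by apply: nbhsx_ballx; rewrite divr_gt0.
near=> s => As.
have [->|st'] := eqVneq s t; first by rewrite subrr normr0.
have qs : `|(h s - h t) / (s - t)| < `|l| + 1.
  by apply: (near near_q s) => //; split=> //; exact/eqP.
have std : `|t - s| < e / (`|l| + 1) by exact: (near st s).
have st0 : 0 < `|s - t| by rewrite normr_gt0 subr_eq0.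
rewrite distrC; move: qs; rewrite normrM normfV ltr_pdivrMr// => /lt_trans; apply.
by rewrite mulrC -ltr_pdivlMr// distrC.
Unshelve. all: by end_near.
Qed.

Lemma positive_lower_bound (d : R) : {within `]0, 1], continuous h} ->
  (forall t, t \in `]0, 1] -> 0 < h t) -> 0 < d ->
  exists2 c, 0 < c & forall t, d <= t < 1 -> c <= h t.
Proof.
move=> ch hpos d0; have [d1|d1] := leP d 1; last first.
  by exists 1 => // t /andP[dt t1]; have := lt_trans (lt_le_trans d1 dt) t1; rewrite ltxx.
have [|m mI mmin] := EVT_min d1 (f := h).
  apply: continuous_subspaceW ch => t /=; rewrite !in_itv/= => /andP[dt ->].
  by rewrite (lt_le_trans d0).
exists (h m).
  by apply: hpos; move: mI; rewrite !in_itv/= => /andP[dm ->]; rewrite (lt_le_trans d0).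
by move=> t /andP[dt t1]; apply: mmin; rewrite in_itv/= dt ltW.
Qed.

End CoefficientRegularity.

Theorem theorem3p4 (R : realType) (h : R -> R) (C theta : R) :
  (* h bounded on [0,1] *)
  (exists Mh : R, forall t, t \in `[0, 1] -> `|h t| <= Mh) ->
  h 0 = 0 ->
  (forall t, t \in `]0, 1] -> 0 < h t) ->
  (* h in C^1(0,1]: a continuous h' on (0,1] which is the derivative of h
     relative to (0,1] (one-sided at 1) *)
  (exists dh : R -> R, {within `]0, 1], continuous dh} /\
     forall t, t \in `]0, 1] ->
       (fun s => (h s - h t) / (s - t)) @ within (`]0, 1] `\ t) (nbhs t)
         --> dh t) ->
  0 < C -> 0 < theta < 1 ->
  (* sup_{x in Omega, 0<r<=d} (int_{B(x,r) cap Omega} 1/h(x1) dx)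
       / |B(x,r) cap Omega|^theta <= C,  d = diam Omega = sqrt 2 *)
  (forall (x : R * R) (r : R), @Omega R x -> 0 < r <= Num.sqrt 2 ->
     (\int[@leb2 R]_(y in eball x r `&` @Omega R) ((h y.1)^-1)%:E
      <= (C * (fine (@leb2 R (eball x r `&` @Omega R))) `^ theta)%:E)%E) ->
  compact_embedding_H1h0_L2 h.
Proof.
move=> _ _ hpos [dh [_ hder]] _ _ _ u M uM.
have ch : {within `]0, 1], continuous h}.
  by apply: continuous_within_of_quotient => t At; exists (dh t); exact: hder.
have I01S : (`]0%R, 1%R[%classic : set R) `<=` `]0%R, 1%R].
  by move=> t; rewrite /= !in_itv/= => /andP[-> /ltW ->].
have mh : measurable_fun (`]0%R, 1%R[%classic : set R) h.
  apply: measurable_funS I01S _; first exact: measurable_itv.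
  by apply: subspace_continuous_measurable_fun; first exact: measurable_itv.
have h0 t : (`]0%R, 1%R[%classic : set R) t -> 0 <= h t.
  by move=> /I01S /hpos /ltW.
have hlow d d0 := positive_lower_bound (d := d) ch hpos d0.
have approx n : exists phi : R * R -> R, [/\ Cc_inf phi,
    (\int[@leb2 R]_(x in @Omega R) ((phi x - u n x) ^+ 2)%:E <= (n.+1%:R^-1)%:E)%E,
    (\int[@leb2 R]_(x in @Omega R) ((pd false phi x) ^+ 2)%:E <= (2 + 2 * M)%:E)%E &
    (\int[@leb2 R]_(x in @Omega R) ((Num.sqrt (h x.1) * pd true phi x) ^+ 2)%:E <= (2 + 2 * M)%:E)%E].
  have [g1 [g2 [ug uM']]] := uM n.
  have n0 : 0 < n.+1%:R^-1 :> R by rewrite invr_gt0 ltr0n.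
  have [phi [cphi phiu phi1 phi2]] := Cc_inf_approx mh ug uM' n0.
  have le2 : ((2 * n.+1%:R^-1 + 2 * M)%:E <= (2 + 2 * M)%:E)%E.
    by rewrite lee_fin lerD2r -[leRHS]mulr1 ler_pM2l// invf_le1 ?ler1n ?ltr0n.
  by exists phi; split; [|exact: phiu|exact: le_trans phi1 le2|exact: le_trans phi2 le2].
have [phi phiP] := choice approx.
have cphi n : Cc_inf (phi n) by case: (phiP n).
have phi1 n : (\int[@leb2 R]_(x in @Omega R) ((pd false (phi n) x) ^+ 2)%:E
    <= (2 + 2 * M)%:E)%E by case: (phiP n).
have phi2 n : (\int[@leb2 R]_(x in @Omega R) ((Num.sqrt (h x.1) * pd true (phi n) x) ^+ 2)%:E
    <= (2 + 2 * M)%:E)%E by case: (phiP n).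
have [U [UU ooU]] := ultraFilterLemma (F := \oo) _.
have ooU' n : U [set m | (n < m)%N] by apply: ooU; exists n.+1.
have close k : exists2 A, U A & forall n m, A n -> A m ->
    (\int[@leb2 R]_(x in @Omega R) ((phi m x - phi n x) ^+ 2)%:E <= (4^-1 ^+ k)%:E)%E.
  have e0 : 0 < 4^-1 ^+ k :> R by rewrite exprn_gt0.
  have [A UA AP] := ultra_total_bounded UU mh h0 hlow cphi phi1 phi2 e0.
  by exists A => // n m An Am; exact: AP m n Am An.
have [sigma [sinc sP]] := ultra_subsequence UU ooU' close.
have mphi n : measurable_fun (@Omega R) (phi n).
  apply: (measurable_funS measurableT) => //; apply: continuous_measurable_prod.
  exact: smooth2_continuous (cphi n).1.
have Lu n : L2 (u n) by have [g1 [g2 [[[]]]]] := uM n.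
have [v mv vcvg] := @L2_complete _ _ R (@leb2 R) (@Omega R) (@measurable_Omega R)
  (fun k => phi (sigma k)) (fun k => mphi (sigma k)) sP.
have mu n : measurable_fun (@Omega R) (u n) := (Lu n).1.
exists sigma, v; split; [|split].
- exact: homo_ltn (fun m n p => @ltn_trans m n p) sinc.
- split=> //.
  have [k _ /(_ k (leqnn k)) vk] : \forall k \near \oo,
      (\int[@leb2 R]_(x in @Omega R) ((phi (sigma k) x - v x) ^+ 2)%:E < 1%:E)%E.
    exact: vcvg _ (@nbhs_open_ereal_lt R 0 (fun=> 1) ltr01).
  have phi_fin : (\int[@leb2 R]_(x in @Omega R) ((phi (sigma k) x) ^+ 2)%:E < +oo)%E.
    apply: (le_lt_trans (integral_sqr_triangle (mphi _) (mu (sigma k)))).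
    apply: lte_add_pinfty; apply: lte_mul_pinfty; rewrite ?lee_fin//; last exact: (Lu _).2.
    by have [_ phiu _ _] := phiP (sigma k); apply: le_lt_trans phiu _; rewrite ltry.
  apply: (le_lt_trans (integral_sqr_triangle mv (mphi (sigma k)))).
  apply: lte_add_pinfty; apply: lte_mul_pinfty; rewrite ?lee_fin//.
  under eq_integral do rewrite -sqrrN opprB.
  by apply: lt_trans vk _; rewrite ltry.
apply: (@squeeze_cvge _ _ _ _ (cst 0%E) _ (fun n => 2%:E * (n.+1%:R^-1)%:E +
    2%:E * \int[@leb2 R]_(x in @Omega R) ((phi (sigma n) x - v x) ^+ 2)%:E)%E).
- near=> n; apply/andP; split.
    by apply: integral_ge0 => x _; rewrite lee_fin sqr_ge0.
  apply: (le_trans (integral_sqr_triangle (measurable_funB (mu _) mv)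
    (measurable_funB (mphi (sigma n)) mv))).
  apply: leeD2r; apply: lee_wpmul2l; first by rewrite lee_fin.
  have [_ phiu _ _] := phiP (sigma n).
  under eq_integral => x _.
    rewrite (_ : u (sigma n) x - v x - (phi (sigma n) x - v x) = - (phi (sigma n) x - u (sigma n) x)); last by ring.
    rewrite sqrrN; over.
  apply: le_trans phiu _; rewrite lee_fin lef_pV2 ?posrE ?ltr0n// ler_nat ltnS.
  elim: {+}n => // m IH; exact: leq_ltn_trans IH (sinc m).
- exact: cvg_cst.
rewrite -[X in _ --> X](_ : 2%:E * 0%:E + 2%:E * 0 = 0)%E; last by rewrite !mule0 adde0.
apply: cvgeD => //; apply: cvgeZl => //.
by apply: cvg_EFin; [exact: nearW|exact: cvg_harmonic].
Unshelve. all: by end_near.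
Qed.
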